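(* Let $M\ge 2$ and $N$ be positive integers, and let $C_0,\dots,C_{N-1}$ be i.i.d. random variables, each uniformly distributed on $\{0,1,\dots,M-1\}$. For $m\in\{0,\dots,M-1\}$ and $n\in\{0,\dots,N-1\}$ let $\zeta_{n,m}=1$ if $C_n=m$ and $\zeta_{n,m}=0$ otherwise, and for an integer $\Delta q$ let $\lambda_m^{\Delta q}=\frac{M}{N}\sum_{n=0}^{N-1}\zeta_{n,m}e^{j2\pi\frac{\Delta q}{N}n}$. Define $\bar\sigma_m^{\Delta q}=|\lambda_m^0-1|$ if $\Delta q=0$ and $\bar\sigma_m^{\Delta q}=|\lambda_m^{\Delta q}|$ if $\Delta q\neq0$. Then for every $0<\epsilon\le1$, every $m\in\{0,\dots,M-1\}$ and every $\Delta q\in\{0,1,\dots,\lfloor N/2\rfloor\}$, $$\mathbb{P}\left(\bar\sigma_m^{\Delta q}>\sqrt{\frac{M-1}{N}}+\epsilon\right)<e^{-\frac{N}{4(M-1)}\epsilon^2}.$$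
   Context: $j$ denotes the imaginary unit. The quantities $\bar\sigma_m^{\Delta q}$ are the singular values of $\bm\Psi_{q_1}^H\bm\Psi_{q_2}$ (minus the identity when $q_1=q_2$) for $\Delta q=q_2-q_1$, where $[\bm\psi_{p,q}]_n=\frac{1}{\sqrt N}e^{j\frac{2\pi p}{M}C_n+j\frac{2\pi q}{N}n}$; this interpretation is not needed for the statement. *)

(* Defs.v *)
From HB Require Import structures.
From mathcomp Require Import all_boot all_order all_algebra.
From mathcomp Require Import complex.
From mathcomp Require Import reals sequences exp trigo.
Set Implicit Arguments. Unset Strict Implicit. Unset Printing Implicit Defensive.
Import Order.TTheory GRing.Theory Num.Theory ComplexField.
Local Open Scope ring_scope.
Local Open Scope complex_scope.

(* An outcome of (C_0,...,C_{N-1}): a function 'I_N -> 'I_M.  The i.i.d.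
   uniform law on {0..M-1} for each C_n is the uniform law on these outcomes. *)
Definition outcome (M N : nat) := {ffun 'I_N -> 'I_M}.

Definition Prob (R : realType) (M N : nat) (E : pred (outcome M N)) : R :=
  #|[set c : outcome M N | E c]|%:R / (M ^ N)%:R.

Definition zeta (M N : nat) (c : outcome M N) (n : 'I_N) (m : 'I_M) : nat :=
  (c n == m).

Definition cexpj (R : realType) (t : R) : R[i] := (cos t) +i* (sin t).

Definition lambda (R : realType) (M N : nat) (c : outcome M N) (m : 'I_M)
    (dq : int) : R[i] :=
  ((M%:R / N%:R : R)%:C) *
  \sum_(n < N) (zeta c n m)%:R *
     cexpj (2 * pi * (dq%:~R / N%:R) * (n%:R : R)).

Definition sigmabar (R : realType) (M N : nat) (c : outcome M N) (m : 'I_M)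
    (dq : int) : R :=
  if dq == 0 then complex.Re `|lambda R c m 0 - 1| else complex.Re `|lambda R c m dq|.

(* Main.v *)
(* Subtracting its expectation, the quantity whose modulus is sigmabar is a sum
   of N independent centred complex terms a(C_n) w_n with |w_n| = 1 (for dq > 0
   the expectation of lambda vanishes because the w_n are powers of a nontrivial
   root of unity).  Its modulus f has second moment v = (M-1)/N, so
   E f <= sqrt v.  Averaging out one coordinate at a time as in the
   bounded-difference method, but with exp u <= 1 + u + u^2 for u <= 1/2 in
   place of Hoeffding's lemma, gives
   E exp(s (f - E f)) <= (1 + s^2 v / N)^N < exp(s^2 v).
   Markov's inequality with s = eps / (2 v) concludes; eps <= 1 keeps each
   exponent u below 1/2. *)
Require Import Defs.
From HB Require Import structures.
From mathcomp Require Import all_boot all_order all_algebra.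
From mathcomp Require Import complex.
From mathcomp Require Import reals sequences exp trigo.
From mathcomp Require Import ring lra zify.
Import Order.TTheory GRing.Theory Num.Theory.
Local Open Scope ring_scope.

(** * Averages over a finite type *)

Definition mean {R : realType} {T : finType} (f : T -> R) : R :=
  (\sum_t f t) / #|T|%:R.

Lemma eq_mean {R : realType} {T : finType} (f g : T -> R) :
  f =1 g -> mean f = mean g.
Proof. by move=> fg; rewrite /mean (eq_bigr g). Qed.

Lemma le_mean {R : realType} {T : finType} (f g : T -> R) :
  (forall t, f t <= g t) -> mean f <= mean g.
Proof. by move=> fg; rewrite ler_wpM2r ?invr_ge0 ?ler0n ?ler_sum. Qed.

Lemma meanD {R : realType} {T : finType} (f g : T -> R) :
  mean (fun t => f t + g t) = mean f + mean g.
Proof. by rewrite /mean big_split mulrDl. Qed.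

Lemma meanZ {R : realType} {T : finType} (k : R) (f : T -> R) :
  mean (fun t => k * f t) = k * mean f.
Proof. by rewrite /mean -mulr_sumr mulrA. Qed.

Lemma mean_cst {R : realType} {T : finType} (k : R) :
  (0 < #|T|)%N -> mean (fun _ : T => k) = k.
Proof.
by move=> T0; rewrite /mean sumr_const -[k *+ _]mulr_natr mulfK ?pnatr_eq0 -?lt0n.
Qed.

Lemma mean_sum {R : realType} {T J : finType} (f : J -> T -> R) :
  mean (fun t => \sum_j f j t) = \sum_j mean (f j).
Proof. by rewrite /mean exchange_big -mulr_suml. Qed.

Lemma normr_mean {R : realType} {T : finType} (f : T -> R) :
  `|mean f| <= mean (fun t => `|f t|).
Proof.
by rewrite normrM (@ger0_norm _ _^-1) ?invr_ge0// ler_wpM2r ?invr_ge0// ler_norm_sum.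
Qed.

Lemma mean_variance {R : realType} {T : finType} (f : T -> R) : (0 < #|T|)%N ->
  mean (fun t => (f t - mean f) ^+ 2)
    = mean (fun t => f t ^+ 2) - mean f ^+ 2.
Proof.
move=> T0; set mu := mean f.
rewrite (@eq_mean _ _ _ (fun t => f t ^+ 2 + (- (2 * mu) * f t + mu ^+ 2))).
  by rewrite !meanD meanZ mean_cst// -/mu; ring.
by move=> t; ring.
Qed.

Lemma sqr_mean_le {R : realType} {T : finType} (f : T -> R) : (0 < #|T|)%N ->
  mean f ^+ 2 <= mean (fun t => f t ^+ 2).
Proof.
move=> T0; rewrite -subr_ge0 -mean_variance//.
by rewrite mulr_ge0 ?invr_ge0 ?sumr_ge0// => t _; rewrite sqr_ge0.
Qed.

(** The variance through two independent copies: pairwise bounds [d t t'] on the differences of [f]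
    then control the variance directly. *)
Lemma mean_variance_pairs {R : realType} {T : finType} (f : T -> R) :
  (0 < #|T|)%N ->
  mean (fun t => (f t - mean f) ^+ 2)
    = mean (fun t => mean (fun t' => (f t - f t') ^+ 2)) / 2.
Proof.
move=> T0; rewrite mean_variance//; set mu := mean f; set q := mean (fun t => f t ^+ 2).
rewrite (@eq_mean _ _ (fun t => mean _) (fun t => f t ^+ 2 + (- (2 * mu) * f t + q))).
  by rewrite !meanD meanZ mean_cst// -/mu -/q; field.
move=> t; rewrite (@eq_mean _ _ _ (fun t' =>
    f t ^+ 2 + (- (2 * f t) * f t' + f t' ^+ 2))).
  by rewrite !meanD (meanZ (- (2 * f t))) mean_cst// -/mu -/q; ring.
by move=> t'; ring.
Qed.

(** * Exponential moments under bounded differences *)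

Lemma expR_le_quadratic {R : realType} (x : R) :
  x <= 2^-1 -> expR x <= 1 + x + x ^+ 2.
Proof.
(* [expR x = expR (x / 3) ^+ 3 <= (1 - x / 3) ^- 3]; the square alone would
   not be sharp enough at [x = 1 / 2]. *)
move=> x2; have y0 : 0 < 1 - x / 3 by lra.
have e1 : 1 - x / 3 <= (expR (x / 3))^-1.
  by rewrite -expRN; apply: le_trans (expR_ge1Dx _); lra.
have e2 : expR (x / 3) <= (1 - x / 3)^-1.
  by rewrite -[leLHS]invrK lef_pV2 ?posrE ?invr_gt0 ?expR_gt0.
have -> : x = x / 3 * 3%:R by field.
rewrite expRM_natr; apply: (@le_trans _ _ ((1 - x / 3)^-1 ^+ 3)).
  by rewrite lerXn2r ?nnegrE ?expR_ge0 ?invr_ge0 ?(ltW y0).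
rewrite exprVn -[leLHS]mul1r ler_pdivrMr ?exprn_gt0//.
have -> : x / 3 * 3%:R = x by field.
(* This cubic is [27 / x ^+ 2] times the excess of [(1 + x + x ^+ 2) * (1 - x / 3) ^+ 3] over 1. *)
have h : 0 <= 9 - 19 * x + 8 * x ^+ 2 - x ^+ 3.
  have [x0|/ltW x0] := leP 0 x.
    have : 0 <= x ^+ 2 * (2^-1 - x) by rewrite mulr_ge0 ?sqr_ge0 ?subr_ge0.
    have := sqr_ge0 (x - 2^-1).
    nra.
  have : 0 <= - x * x ^+ 2 by rewrite mulr_ge0 ?sqr_ge0 ?oppr_ge0.
  by have := sqr_ge0 x; rewrite (exprS x 2); nra.
have -> : (1 + x + x ^+ 2) * (1 - x / 3) ^+ 3
    = 1 + x ^+ 2 * (9 - 19 * x + 8 * x ^+ 2 - x ^+ 3) / 27.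
  by field.
by rewrite lerDl divr_ge0 //; apply: mulr_ge0 h; rewrite sqr_ge0.
Qed.

(** Apply the quadratic bound to [u = s * (f - mean f)]: the linear term averages to 0 and the
    square gives the variance. Since [f t - mean f] averages [f t - f t'] over [t'], a bound on the
    row averages of [d], rather than on its maximum, keeps [u] below 1/2. *)
Lemma mean_expR_le {R : realType} {T : finType} (d : T -> T -> R) (s : R) (f : T -> R) :
  (0 < #|T|)%N -> 0 <= s ->
  (forall t, s * mean (d t) <= 2^-1) ->
  (forall t t', `|f t - f t'| <= d t t') ->
  mean (fun t => expR (s * f t)) <=
  expR (s * mean f)
    * (1 + s ^+ 2 * (mean (fun t => mean (fun t' => d t t' ^+ 2)) / 2)).
Proof.
move=> T0 s0 dB fd; set mu := mean f.
have f_mu t : f t - mu = mean (fun t' => f t - f t').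
  rewrite (@eq_mean _ _ _ (fun t' => f t + (-1) * f t')); last by move=> t'; ring.
  by rewrite meanD meanZ mean_cst// mulN1r.
have u2 t : s * (f t - mu) <= 2^-1.
  apply: le_trans (dB t); rewrite ler_wpM2l// f_mu le_mean// => t'.
  exact: le_trans (ler_norm _) (fd t t').
pose u t := s * (f t - mu).
apply: (@le_trans _ _ (mean (fun t => expR (s * mu) * (1 + (u t + u t ^+ 2))))).
  apply: le_mean => t; have -> : s * f t = s * mu + u t by rewrite /u; ring.
  by rewrite expRD ler_wpM2l ?expR_ge0// addrA; exact: expR_le_quadratic (u2 t).
rewrite meanZ ler_wpM2l ?expR_ge0// meanD mean_cst// lerD2l meanD.
have -> : mean u = 0.
  rewrite /u meanZ meanD mean_cst//.
  by rewrite -/mu subrr mulr0.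
rewrite add0r (@eq_mean _ _ _ (fun t => s ^+ 2 * (f t - mu) ^+ 2)); last first.
  by move=> t; rewrite /u exprMn.
rewrite meanZ ler_wpM2l ?sqr_ge0// /mu mean_variance_pairs// ler_wpM2r ?invr_ge0//.
apply: le_mean => t; apply: le_mean => t'; rewrite -real_normK ?num_real//.
by rewrite lerXn2r ?nnegrE ?(le_trans (normr_ge0 _) (fd t t')).
Qed.

(** * Product spaces: resampling one coordinate *)

Definition upd {I T : finType} (c : {ffun I -> T}) (i : I) (t : T) : {ffun I -> T} :=
  [ffun j => if j == i then t else c j].

(** Exchanging the fresh value [t] with the coordinate [c i] is an involution on pairs [(c, t)], so
    resampling preserves the uniform law. *)
Lemma mean_upd {R : realType} {I T : finType} (i : I) (f : {ffun I -> T} -> R) :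
  (0 < #|T|)%N -> mean (fun c => mean (fun t => f (upd c i t))) = mean f.
Proof.
move=> T0; transitivity (mean (fun c => mean (fun _ : T => f c))); last first.
  by apply: eq_mean => c; exact: mean_cst.
rewrite /mean -!mulr_suml; congr (_ / _ / _).
rewrite !pair_bigA /=.
pose phi (p : {ffun I -> T} * T) := (upd p.1 i p.2, p.1 i).
have phiK : involutive phi.
  case=> c t; rewrite /phi /= /upd !ffunE eqxx; congr (_, _).
  by apply/ffunP => j; rewrite !ffunE; case: eqP => // ->.
by rewrite [RHS](reindex phi)//; exists phi => p _; exact: phiK.
Qed.

(** Averaging out a coordinate costs one factor [v] by [mean_expR_le]; the averaged function [g]
    keeps the same mean and the same difference bounds. *)
Lemma mean_expR_product_le {R : realType} {I T : finType} (d : T -> T -> R) (s : R)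
    (f : {ffun I -> T} -> R) :
  (0 < #|T|)%N -> 0 <= s ->
  (forall t, s * mean (d t) <= 2^-1) ->
  (forall c i t t', `|f (upd c i t) - f (upd c i t')| <= d t t') ->
  mean (fun c => expR (s * f c)) <=
  expR (s * mean f)
    * (1 + s ^+ 2 * (mean (fun t => mean (fun t' => d t t' ^+ 2)) / 2)) ^+ #|I|.
Proof.
move=> T0 s0 dB; set v := 1 + _.
have v0 : 0 <= v.
  have mean_ge0 (T' : finType) (g : T' -> R) : (forall t, 0 <= g t) -> 0 <= mean g.
    by move=> g0; rewrite mulr_ge0 ?invr_ge0 ?sumr_ge0.
  rewrite addr_ge0// mulr_ge0 ?sqr_ge0// divr_ge0// !mean_ge0// => t.
  by rewrite mean_ge0// => t'; rewrite sqr_ge0.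
rewrite cardE.
(* The induction is over the coordinates on which f may still depend. *)
have : forall c c' : {ffun I -> T}, {in enum I, c =1 c'} -> f c = f c'.
  by move=> c c' cc'; congr f; apply/ffunP => j; rewrite cc' ?mem_enum.
elim: (enum I) f => [|i r IH] f fr fd.
  have /card_gt0P[t _] := T0; pose c0 : {ffun I -> T} := [ffun=> t].
  have C0 : (0 < #|{ffun I -> T}|)%N by apply/card_gt0P; exists c0.
  rewrite (@eq_mean _ _ _ (fun=> expR (s * f c0))); last by move=> c; rewrite (fr c c0).
  rewrite (@eq_mean _ _ f (fun=> f c0)); last by move=> c; rewrite (fr c c0).
  by rewrite !mean_cst// expr0 mulr1.
pose g c := mean (fun t => f (upd c i t)).
have gr (c c' : {ffun I -> T}) : {in r, c =1 c'} -> g c = g c'.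
  move=> cc'; apply: eq_mean => t; apply: fr => j.
  by rewrite inE /upd !ffunE; case: eqP => //= _ /cc'.
have gd c k t t' : `|g (upd c k t) - g (upd c k t')| <= d t t'.
  rewrite /g -mulN1r -meanZ -meanD; apply: le_trans (normr_mean _) _.
  rewrite -[leRHS](mean_cst _ T0); apply: le_mean => x; rewrite mulN1r.
  (* For [k = i] the averaging overwrites the change, so the difference is 0; otherwise the two
     updates commute and the bound for [f] applies. *)
  have [<-|ik] := eqVneq i k.
    have e y : upd (upd c i y) i x = upd c i x.
      by apply/ffunP => j; rewrite /upd !ffunE; case: eqP.
    by rewrite !e subrr normr0 (le_trans (normr_ge0 _) (fd c i t t')).
  have e y : upd (upd c k y) i x = upd (upd c i x) k y.
    apply/ffunP => j; rewrite /upd !ffunE.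
    by have [->|//] := eqVneq j i; rewrite (negPf ik).
  by rewrite !e fd.
rewrite -(mean_upd i (fun c => expR _))// -(mean_upd i f)// -/g.
apply: (@le_trans _ _ (mean (fun c => v * expR (s * g c)))).
  by apply: le_mean => c; rewrite mulrC; apply: mean_expR_le.
by rewrite meanZ exprS [leRHS]mulrCA ler_wpM2l// IH.
Qed.

Lemma mean_sqr_lincomb {R : realType} {I T : finType} (a : T -> R) (x : I -> R) :
  (0 < #|T|)%N -> mean a = 0 ->
  mean (fun c : {ffun I -> T} => (\sum_i a (c i) * x i) ^+ 2)
    = mean (fun t => a t ^+ 2) * \sum_i x i ^+ 2.
Proof.
move=> T0 a0; have /card_gt0P[t0 _] := T0.
have C0 : (0 < #|{ffun I -> T}|)%N by apply/card_gt0P; exists [ffun=> t0].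
transitivity (mean (fun c : {ffun I -> T} =>
    \sum_i \sum_j (a (c i) * x i) * (a (c j) * x j))).
  apply: eq_mean => c; rewrite expr2 mulr_suml.
  by apply: eq_bigr => i _; rewrite mulr_sumr.
rewrite mean_sum mulr_sumr; apply: eq_bigr => i _.
rewrite mean_sum (bigD1 i)//= big1 ?addr0 => [|j ji]; rewrite -(mean_upd i)//.
  transitivity (mean (fun _ : {ffun I -> T} => mean (fun t => x i ^+ 2 * a t ^+ 2))).
    apply: eq_mean => c; apply: eq_mean => t.
    by rewrite /upd !ffunE eqxx; ring.
  by rewrite mean_cst// meanZ mulrC.
transitivity (mean (fun _ : {ffun I -> T} => 0 : R)); last exact: mean_cst.
apply: eq_mean => c.
(* Resampling coordinate [i] leaves [c j] fixed, so each cross term carries the factor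
   [mean a = 0]. *)
transitivity (mean (fun t => (x i * (a (c j) * x j)) * a t)).
  apply: eq_mean => t; rewrite /upd !ffunE eqxx (negPf ji); ring.
by rewrite meanZ a0 mulr0.
Qed.

(** * Tail bounds on product spaces *)

Lemma bernstein_product {R : realType} {I T : finType} (d : T -> T -> R)
    (f : {ffun I -> T} -> R) (v eps : R) :
  (0 < #|I|)%N -> (0 < #|T|)%N -> 0 < v -> 0 < eps ->
  #|I|%:R * (mean (fun t => mean (fun t' => d t t' ^+ 2)) / 2) = v ->
  (forall t, eps * mean (d t) <= v) ->
  (forall c i t t', `|f (upd c i t) - f (upd c i t')| <= d t t') ->
  mean (fun c => (mean f + eps < f c)%R%:R) < expR (- eps ^+ 2 / (4 * v)).
Proof.
move=> I0 T0 v0 e0 vE dB fd; set mu := mean f; set w := _ / 2 in vE.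
(* This [s] minimises the Markov exponent [- s * eps + s ^+ 2 * v], with value
   [- eps ^+ 2 / (4 * v)]; the hypothesis on [eps * mean (d t)] becomes [s * mean (d t) <= 1/2]. *)
pose s := eps / (2 * v).
have s0 : 0 < s by rewrite divr_gt0 ?mulr_gt0.
have sB t : s * mean (d t) <= 2^-1.
  have -> : s * mean (d t) = (eps * mean (d t)) / v / 2 by rewrite /s; field; lra.
  by rewrite -[leRHS]mul1r ler_wpM2r ?invr_ge0// ler_pdivrMr// mul1r.
have n0 : 0 < #|I|%:R :> R by rewrite ltr0n.
have w0 : 0 < w by rewrite -(pmulr_rgt0 _ n0) vE.
apply: (@le_lt_trans _ _ (mean (fun c => expR (- (s * (mu + eps))) * expR (s * f c)))).
  apply: le_mean => c; rewrite -expRD; case: ltP => [fc|_]; last exact: expR_ge0.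
  by apply: le_trans (expR_ge1Dx _); rewrite lerDl addrC subr_ge0 ler_wpM2l ?ltW.
rewrite meanZ; apply: (@le_lt_trans _ _
    (expR (- (s * (mu + eps))) * (expR (s * mu) * (1 + s ^+ 2 * w) ^+ #|I|))).
  by rewrite ler_wpM2l ?expR_ge0// mean_expR_product_le ?ltW.
have -> : - eps ^+ 2 / (4 * v)
    = - (s * (mu + eps)) + (s * mu + #|I|%:R * (s ^+ 2 * w)).
  by rewrite [_ * (s ^+ 2 * w)]mulrCA vE /s; field; lra.
rewrite !expRD ltr_pM2l ?expR_gt0// ltr_pM2l ?expR_gt0// expRM_natl.
have sw0 : 0 < s ^+ 2 * w by rewrite mulr_gt0 ?exprn_gt0.
(* Strictness comes from [1 + x < expR x] at [x = s ^+ 2 * w > 0], raised to a positive power. *)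
rewrite ltrXn2r -?lt0n ?expR_gt1Dx ?gt_eqF ?addr_ge0 ?ler01 ?(ltW sw0)//.
Qed.

(** The reverse triangle inequality for the modulus in the complex plane. *)
Lemma dist_sqrt_sqr_le {R : realType} (p q p' q' : R) :
  `|Num.sqrt (p ^+ 2 + q ^+ 2) - Num.sqrt (p' ^+ 2 + q' ^+ 2)|
    <= Num.sqrt ((p - p') ^+ 2 + (q - q') ^+ 2).
Proof. exact: (@ler_dist_dist _ (Rcomplex R) (Complex p q) (Complex p' q')). Qed.

(** By orthogonality the squared modulus has mean [v], so the modulus has mean at most [Num.sqrt v].
    Changing coordinate [i] moves the planar sum by [a t - a t'] times the unit vector [(x i, y i)],
    whence [d t t' = |a t - a t'|]. *)
Lemma bernstein_plane {R : realType} {I T : finType} (a : T -> R) (x y : I -> R)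
    (v eps : R) :
  (0 < #|I|)%N -> (0 < #|T|)%N -> 0 < v -> 0 < eps ->
  mean a = 0 -> #|I|%:R * mean (fun t => a t ^+ 2) = v ->
  (forall t, eps * mean (fun t' => `|a t - a t'|) <= v) ->
  (forall i, x i ^+ 2 + y i ^+ 2 = 1) ->
  mean (fun c : {ffun I -> T} => (Num.sqrt v + eps <
      Num.sqrt ((\sum_i a (c i) * x i) ^+ 2 + (\sum_i a (c i) * y i) ^+ 2))%R%:R)
    < expR (- eps ^+ 2 / (4 * v)).
Proof.
move=> I0 T0 v0 e0 a0 vE aB xy.
have /card_gt0P[t0 _] := T0.
have C0 : (0 < #|{ffun I -> T}|)%N by apply/card_gt0P; exists [ffun=> t0].
set f := fun c : {ffun I -> T} =>
  Num.sqrt ((\sum_i a (c i) * x i) ^+ 2 + (\sum_i a (c i) * y i) ^+ 2).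
have Ef : mean f <= Num.sqrt v.
  have -> : v = mean (fun c => f c ^+ 2).
    under eq_mean do rewrite sqr_sqrtr ?addr_ge0 ?sqr_ge0//.
    rewrite meanD !mean_sqr_lincomb// -mulrDr -big_split/=.
    by under eq_bigr do rewrite xy; rewrite sumr_const mulrC -vE.
  by rewrite (le_trans (ler_norm _))// -sqrtr_sqr ler_wsqrtr// sqr_mean_le.
apply: (@le_lt_trans _ _ (mean (fun c => (mean f + eps < f c)%R%:R))).
  apply: le_mean => c; rewrite ler_nat; case: ltP => //= h.
  by rewrite (le_lt_trans _ h)// lerD2r.
apply: (@bernstein_product _ _ _ (fun t t' => `|a t - a t'|)) => // [|c i t t'].
  rewrite -vE; congr (_ * _).
  under eq_mean do under eq_mean do rewrite real_normK ?num_real//.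
  by rewrite -mean_variance_pairs// a0; apply: eq_mean => t; rewrite subr0.
have diff (z : I -> R) : \sum_j a (upd c i t j) * z j - \sum_j a (upd c i t' j) * z j
    = (a t - a t') * z i.
  rewrite -sumrB (bigD1 i)//= big1 ?addr0 => [|j ji]; rewrite /upd !ffunE ?eqxx.
    by rewrite mulrBl.
  by rewrite (negPf ji) subrr.
apply: le_trans (dist_sqrt_sqr_le _ _ _ _) _.
by rewrite !diff !exprMn -mulrDr xy mulr1 sqrtr_sqr.
Qed.

(** * Application to the random coefficients *)

Lemma Prob_mean (R : realType) (M N : nat) (E : pred (outcome M N)) :
  Prob R E = mean (fun c => (E c)%:R).
Proof.
rewrite /Prob /mean card_ffun !card_ord; congr (_ / _).
rewrite -sum1_card natr_sum big_mkcond; apply: eq_bigr => c _.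
by rewrite inE; case: (E c).
Qed.

Lemma mean_indicator {R : realType} {T : finType} (m : T) :
  mean (fun t => (t == m)%:R) = #|T|%:R^-1 :> R.
Proof.
rewrite /mean (bigD1 m)//= eqxx big1 ?addr0 ?mul1r// => t /negPf -> //.
Qed.

Lemma sum_complex {R : realType} {I : finType} (u v : I -> R) :
  \sum_i Complex (u i) (v i) = Complex (\sum_i u i) (\sum_i v i).
Proof. by elim/big_rec3: _ => // i p q z _ ->. Qed.

Lemma cexpj_natM {R : realType} (t : R) (n : nat) :
  cexpj (t * n%:R) = cexpj t ^+ n.
Proof.
elim: n => [|n IH]; first by rewrite mulr0 /cexpj cos0 sin0.
by rewrite exprSr -IH -natr1 mulrDr mulr1 /cexpj cosD sinD; congr Complex; ring.
Qed.

Lemma sum_cexpj_eq0 {R : realType} (N k : nat) : (0 < k <= N./2)%N ->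
  \sum_(n < N) cexpj (2 * pi * (k%:R / N%:R) * n%:R) = 0 :> R[i].
Proof.
move=> /andP[k0 kN].
have N0 : (0 < N)%N by lia.
have N0' : 0 < N%:R :> R by rewrite ltr0n.
set t := 2 * pi * _; under eq_bigr do rewrite cexpj_natM.
have wN : cexpj t ^+ N = 1.
  have -> : cexpj t ^+ N = cexpj (pi *+ 2) ^+ k.
    by rewrite -!cexpj_natM; congr cexpj; rewrite /t; field; lra.
  by rewrite /cexpj cos2pi sin2pi expr1n.
have w1 : cexpj t != 1.
  (* The bound [k <= N./2] puts the angle [t] in [(0, pi]], where [cos] is injective together with
     0, so [cexpj t] is not 1. *)
  have p0 : 0 < pi :> R := pi_gt0 R.
  have kN' : 2 * k%:R <= N%:R :> R by rewrite -natrM ler_nat; lia.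
  have t0 : 0 < t by rewrite !mulr_gt0 ?invr_gt0 ?ltr0n.
  have tpi : t <= pi.
    rewrite -[leRHS]mulr1 /t [2 * pi]mulrC -mulrA ler_wpM2l ?(ltW p0)// mulrA.
    by rewrite ler_pdivrMr// mul1r.
  apply/eqP => -[c1 _].
  have : cos t < cos 0 by rewrite ltr_cos ?in_itv/= ?lexx ?(ltW p0) ?(ltW t0).
  by rewrite cos0 c1 ltxx.
apply/eqP; have := subrX1 (cexpj t) N; rewrite wN subrr => /esym/eqP.
by rewrite mulf_eq0 subr_eq0 (negPf w1).
Qed.

Lemma sigmabarE {R : realType} (M N : nat) (c : outcome M N) (m : 'I_M) (dq : nat) :
  (0 < M)%N -> (0 < N)%N -> (dq <= N./2)%N ->
  let t n : R := 2 * pi * (dq%:R / N%:R) * n%:R in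
  let a (k : 'I_M) : R := M%:R / N%:R * ((k == m)%:R - M%:R^-1) in
  sigmabar R c m dq%:Z =
  Num.sqrt ((\sum_(n < N) a (c n) * cos (t n)) ^+ 2
            + (\sum_(n < N) a (c n) * sin (t n)) ^+ 2).
Proof.
move=> M0 N0 dqN t a.
have M0' : M%:R != 0 :> R by rewrite pnatr_eq0 -lt0n.
have N0' : N%:R != 0 :> R by rewrite pnatr_eq0 -lt0n.
set p := \sum_n _ * cos _; set q := \sum_n _ * sin _.
(* Centring the indicators splits off their mean 1/M, whose contribution is 1 when [dq = 0] and
   vanishes otherwise. This is what the two cases of [sigmabar] subtract. *)
have lambdaE : lambda R c m dq%:Z
    = Complex p q + (N%:R^-1)%:C%C * \sum_(n < N) cexpj (t n).
  rewrite -sum_complex /lambda !mulr_sumr -big_split; apply: eq_bigr => n _.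
  have -> : Complex (a (c n) * cos (t n)) (a (c n) * sin (t n))
      = (a (c n))%:C%C * cexpj (t n).
    by congr Complex => /=; ring.
  rewrite /= -mulrDl -rmorphD/= mulrA -pmulrn -/(t n); congr (_ * _).
  rewrite -(rmorph_nat (real_complex R)) -rmorphM/=; congr (_%:C)%C.
  by rewrite /a /zeta; field; rewrite M0' N0'.
rewrite /sigmabar; have [dq0|dq0] := eqVneq dq 0%N.
  have e : lambda R c m 0 = lambda R c m dq%:Z by rewrite dq0.
  rewrite ifT; last by rewrite dq0.
  rewrite e lambdaE.
  have -> : \sum_(n < N) cexpj (t n) = N%:R.
    rewrite (eq_bigr (fun=> 1)) ?sumr_const ?card_ord// => n _.
    by rewrite /t dq0 mul0r mulr0 mul0r /cexpj cos0 sin0.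
  by rewrite -(rmorph_nat (real_complex R)) -rmorphM/= mulVf// addrK addr0 subr0.
by rewrite ifN// lambdaE sum_cexpj_eq0 ?mulr0 ?addr0// lt0n dq0.
Qed.

Theorem theorem2 (R : realType) (M N : nat) (hM : (2 <= M)%N) (hN : (0 < N)%N)
    (eps : R) (heps0 : 0 < eps) (heps1 : eps <= 1) (m : 'I_M) (dq : nat)
    (hdq : (dq <= N./2)%N) :
  Prob R (fun c : outcome M N =>
            sigmabar R c m dq%:Z > Num.sqrt ((M%:R - 1) / N%:R) + eps)
  < expR (- (N%:R / (4 * (M%:R - 1))) * eps ^+ 2).
Proof.
have M2 : 2 <= M%:R :> R by rewrite ler_nat.
have N0 : 0 < N%:R :> R by rewrite ltr0n.
have M0 : (0 < M)%N by lia.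
set v := (M%:R - 1) / N%:R.
have v0 : 0 < v by rewrite divr_gt0//; lra.
have I0 : (0 < #|'I_M|)%N by rewrite card_ord.
pose a (k : 'I_M) : R := M%:R / N%:R * ((k == m)%:R - M%:R^-1).
have indM : mean (fun k : 'I_M => (k == m)%:R) = M%:R^-1 :> R.
  by rewrite mean_indicator card_ord.
have -> : - (N%:R / (4 * (M%:R - 1))) * eps ^+ 2 = - eps ^+ 2 / (4 * v).
  by rewrite /v; field; lra.
rewrite Prob_mean; under eq_mean do rewrite sigmabarE//.
pose t n : R := 2 * pi * (dq%:R / N%:R) * n%:R.
apply: (@bernstein_plane _ _ _ a 
  (fun n : 'I_N => cos (t n)) (fun n : 'I_N => sin (t n)));
  rewrite ?card_ord//.
- by rewrite meanZ meanD mean_cst// indM subrr mulr0.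
(* An indicator equals its own square, so [a k ^+ 2] is affine in it, with mean
   [(M - 1) / N ^ 2]. *)
- rewrite (@eq_mean _ _ _ (fun k => (M%:R / N%:R) ^+ 2
      * ((1 - 2 / M%:R) * (k == m)%:R + M%:R^-1 ^+ 2))); last first.
    by move=> k; rewrite /a; case: (k == m); rewrite /=; field; lra.
  by rewrite meanZ meanD meanZ mean_cst// indM /v; field; lra.
(* Here [eps <= 1] enters: it remains to bound the mean of [|a k - a t'|] by [v]. *)
- move=> k; apply: le_trans (_ : mean (fun t' => `|a k - a t'|) <= _).
    by rewrite ler_piMl// mulr_ge0 ?invr_ge0 ?sumr_ge0.
  have MN0 : 0 < M%:R / N%:R :> R by rewrite divr_gt0//; lra.
  under eq_mean do rewrite /a -mulrBr normrM gtr0_norm// opprB addrA subrK.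
  (* The mean is exactly [v = (M - 1) / N] for [k = m], and [1 / N] for the other [k], which is at
     most [v] because [M >= 2]. *)
  rewrite meanZ; have [km|km] := eqVneq k m.
    rewrite (@eq_mean _ _ _ (fun k' => 1 + (-1) * (k' == m)%:R)); last first.
      by move=> k'; case: (k' == m); rewrite /= ?subrr ?normr0 ?subr0 ?normr1; ring.
    by rewrite meanD meanZ mean_cst// indM le_eqVlt; apply/orP; left; apply/eqP;
       rewrite /v; field; lra.
  under eq_mean do rewrite sub0r normrN normr_nat.
  by rewrite indM mulrAC divff ?lt0r_neq0 ?ltr0n// ler_wpM2r ?invr_ge0//; lra.
- by move=> n; rewrite cos2Dsin2.
Qed.
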